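(* Let $n,m\in\mathbb N_0$, let $q\in\mathbb C$ with $q\neq 0$, $|q|\ne 1$, and let $\alpha,\beta\in\mathbb C$, such that no denominator below vanishes. Put $$y_n:=\tfrac12\left(q^{\frac{\alpha+\beta+1}{2}+n}+q^{-\frac{\alpha+\beta+1}{2}-n}\right).$$ Then the continuous $q$-Jacobi polynomials $P_n^{(\alpha,\beta)}(x|q)$ and the Askey--Wilson polynomials $p_m(x;a,b,c,d|q)$ satisfy $$P_n^{(\alpha,\beta)}\left(\tfrac12(q^{\frac{\alpha}{2}+\frac14+m}+q^{-\frac{\alpha}{2}-\frac14-m})\big|q\right)=\frac{(q^{\alpha+1};q)_n\,\left(q^{\frac12(\alpha+\beta+1)}\right)^m}{(q;q)_n\,(q^{\alpha+1},-q^{\frac12(\alpha+\beta+1)},-q^{\frac12(\alpha+\beta+2)};q)_m}\;p_m\left(y_n;q^{\frac12(\alpha+\beta+1)},q^{\frac12(\alpha-\beta+1)},-q^{\frac12},-1\big|q\right),$$ $$P_n^{(\alpha,\beta)}\left(\tfrac12(q^{\frac{\alpha}{2}+\frac34+m}+q^{-\frac{\alpha}{2}-\frac34-m})\big|q\right)=\frac{q^{-\frac n2}\left(q^{\frac12(\alpha+\beta+1)}\right)^m(q^{\alpha+1},-q^{\frac12(\alpha+\beta+3)};q)_n}{(q,-q^{\frac12(\alpha+\beta+1)};q)_n\,(q^{\alpha+1},-q^{\frac12(\alpha+\beta+2)},-q^{\frac12(\alpha+\beta+3)};q)_m}\;p_m\left(y_n;q^{\frac12(\alpha+\beta+1)},q^{\frac12(\alpha-\beta+1)},-q^{\frac12},-q\big|q\right),$$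 $$P_n^{(\alpha,\beta)}\left(-\tfrac12(q^{\frac{\beta}{2}+\frac14+m}+q^{-\frac{\beta}{2}-\frac14-m})\big|q\right)=\frac{\left(-q^{\frac12(\alpha-\beta)}\right)^n\left(q^{\frac12(\alpha+\beta+1)}\right)^m(q^{\beta+1};q)_n}{(q;q)_n\,(q^{\beta+1},-q^{\frac12(\alpha+\beta+1)},-q^{\frac12(\alpha+\beta+2)};q)_m}\;p_m\left(y_n;q^{\frac12(\alpha+\beta+1)},q^{\frac12(\beta-\alpha+1)},-q^{\frac12},-1\big|q\right),$$ $$P_n^{(\alpha,\beta)}\left(-\tfrac12(q^{\frac{\beta}{2}+\frac34+m}+q^{-\frac{\beta}{2}-\frac34-m})\big|q\right)=\frac{\left(-q^{\frac12(\alpha-\beta-1)}\right)^n\left(q^{\frac12(\alpha+\beta+1)}\right)^m(q^{\beta+1},-q^{\frac12(\alpha+\beta+3)};q)_n}{(q,-q^{\frac12(\alpha+\beta+1)};q)_n\,(q^{\beta+1},-q^{\frac12(\alpha+\beta+2)},-q^{\frac12(\alpha+\beta+3)};q)_m}\;p_m\left(y_n;q^{\frac12(\alpha+\beta+1)},q^{\frac12(\beta-\alpha+1)},-q^{\frac12},-q\big|q\right).$$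
   Context: Complex powers of $q$: fix a logarithm $\log q$ and set $q^s:=\exp(s\log q)$. Notation: $(a;q)_n:=\prod_{k=0}^{n-1}(1-aq^k)$, and $(a_1,\dots,a_r;q)_n:=\prod_i (a_i;q)_n$. Askey--Wilson polynomials: for $x=\frac12(z+z^{-1})$, $z\in\mathbb C\setminus\{0\}$, $$p_n(x;a,b,c,d|q):=a^{-n}(ab,ac,ad;q)_n\sum_{k=0}^n\frac{(q^{-n},q^{n-1}abcd,az,az^{-1};q)_k}{(q,ab,ac,ad;q)_k}q^k,$$ where $(ab;q)_n/(ab;q)_k$ is read as $(abq^k;q)_{n-k}$ (likewise for $ac$, $ad$), so that $p_n$ is always defined. Continuous $q$-Jacobi polynomials: $$P_n^{(\alpha,\beta)}(x|q):=\frac{q^{(\frac{\alpha}{2}+\frac14)n}}{(q,-q^{\frac{\alpha+\beta+1}{2}},-q^{\frac{\alpha+\beta+2}{2}};q)_n}\,p_n\left(x;q^{\frac{\alpha}{2}+\frac14},q^{\frac{\alpha}{2}+\frac34},-q^{\frac{\beta}{2}+\frac14},-q^{\frac{\beta}{2}+\frac34}\big|q\right).$$ *)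

(* Defs.v *)
From HB Require Import structures.
From mathcomp Require Import all_boot all_order all_algebra.
From mathcomp Require Import complex.
From mathcomp Require Import reals sequences exp trigo.
From mathcomp Require Import ring.

Set Implicit Arguments.
Unset Strict Implicit.
Unset Printing Implicit Defensive.

Import Order.TTheory GRing.Theory Num.Theory.
Local Open Scope ring_scope.
Local Open Scope complex_scope.

Definition cexp (R : realType) (s : R[i]) : R[i] :=
  (expR (complex.Re s))%:C * (cos (complex.Im s) +i* sin (complex.Im s)).

(* The power q ^ s for the branch fixed by the logarithm [logq] of q. *)
Definition cpow (R : realType) (logq s : R[i]) : R[i] := cexp (s * logq).

(* (a_1, ..., a_r; q)_n with [s = [:: a_1; ...; a_r]] *)
Definition qpoch (F : fieldType) (s : seq F) (q : F) (n : nat) : F :=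
  \prod_(a <- s) \prod_(k < n) (1 - a * q ^+ k).

(* The Askey-Wilson polynomial in terms of z, where x = (z + 1/z) / 2.  The
   quotients (ab;q)_n / (ab;q)_k, and likewise for ac and ad, are entered in
   the reduced form (ab q^k;q)_(n-k), so no condition on ab, ac, ad is needed. *)
Definition askey_wilson_z (F : fieldType) (q : F) (n : nat) (z a b c d : F) : F :=
  a ^- n * \sum_(k < n.+1)
    qpoch [:: a * b * q ^+ k; a * c * q ^+ k; a * d * q ^+ k] q (n - k)
    * (qpoch [:: q ^- n; q ^ (n%:Z - 1) * a * b * c * d; a * z; a * z^-1] q k
       / qpoch [:: q] q k)
    * q ^+ k.

(* A nonzero z with x = (z + 1/z) / 2; the other solution is 1/z. *)
Definition joukowsky_inv (C : numClosedFieldType) (x : C) : C :=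
  x + sqrtC (x ^+ 2 - 1).

Definition askey_wilson (C : numClosedFieldType) (q : C) (n : nat)
    (x a b c d : C) : C :=
  askey_wilson_z q n (joukowsky_inv x) a b c d.

Lemma joukowsky_inv_mul (C : numClosedFieldType) (x : C) :
  joukowsky_inv x * (x - sqrtC (x ^+ 2 - 1)) = 1.
Proof.
rewrite /joukowsky_inv mulrC -subr_sqr sqrtCK; ring.
Qed.

Lemma joukowsky_inv_neq0 (C : numClosedFieldType) (x : C) :
  joukowsky_inv x != 0.
Proof.
apply/eqP => h; have := joukowsky_inv_mul x.
by rewrite h mul0r => /esym/eqP; rewrite oner_eq0.
Qed.

Lemma joukowsky_invK (C : numClosedFieldType) (x : C) :
  (joukowsky_inv x + (joukowsky_inv x)^-1) / 2 = x.
Proof.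
have -> : (joukowsky_inv x)^-1 = x - sqrtC (x ^+ 2 - 1).
  apply: (mulfI (joukowsky_inv_neq0 x)).
  by rewrite divff ?joukowsky_inv_neq0 // joukowsky_inv_mul.
by rewrite /joukowsky_inv; field.
Qed.

Lemma askey_wilson_zV (F : fieldType) (q : F) n (z a b c d : F) :
  askey_wilson_z q n z^-1 a b c d = askey_wilson_z q n z a b c d.
Proof.
rewrite /askey_wilson_z; congr (_ * _); apply: eq_bigr => k _.
congr (_ * (_ / _) * _); rewrite /qpoch !big_cons big_nil invrK.
by rewrite (mulrCA (\prod_(_ < _) (1 - a / z * _))).
Qed.

(* The value does not depend on the choice made in [joukowsky_inv]. *)
Lemma askey_wilsonE (C : numClosedFieldType) (q : C) n (z a b c d : C) :
  z != 0 ->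
  askey_wilson q n ((z + z^-1) / 2) a b c d = askey_wilson_z q n z a b c d.
Proof.
move=> z0; rewrite /askey_wilson /joukowsky_inv.
have -> : ((z + z^-1) / 2) ^+ 2 - 1 = ((z - z^-1) / 2) ^+ 2 by field.
have /eqP := sqrtCK (((z - z^-1) / 2) ^+ 2).
rewrite eqf_sqr => /orP[] /eqP ->.
  by congr (askey_wilson_z _ _ _ _ _ _ _); field.
rewrite -askey_wilson_zV; congr (askey_wilson_z _ _ _ _ _ _ _).
by apply: invr_inj; rewrite invrK; field.
Qed.

Definition continuous_q_jacobi_denom (R : realType) (q logq : R[i]) (n : nat)
    (alpha beta : R[i]) : R[i] :=
  qpoch [:: q; - cpow logq ((alpha + beta + 1) / 2);
            - cpow logq ((alpha + beta + 2) / 2)] q n.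

Definition continuous_q_jacobi (R : realType) (q logq : R[i]) (n : nat)
    (alpha beta x : R[i]) : R[i] :=
  cpow logq ((alpha / 2 + 1 / 4) * n%:R)
  / continuous_q_jacobi_denom q logq n alpha beta
  * askey_wilson q n x
      (cpow logq (alpha / 2 + 1 / 4)) (cpow logq (alpha / 2 + 3 / 4))
      (- cpow logq (beta / 2 + 1 / 4)) (- cpow logq (beta / 2 + 3 / 4)).

(* Main.v *)
(* Evaluated at z = a q^m, the terminating sum defining p_n becomes symmetric in
   n and m up to prefactors, which gives a duality between p_n and p_m with dual
   parameters.  The four evaluation points are e q^m with e one of the four
   parameters of the continuous q-Jacobi polynomial, so the four identities are
   this duality applied after moving e to the front.  That p_n is symmetric in all
   its parameters, not only in b, c, d, follows by induction on n from the backward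
   shift relation, which expresses (1/z - z) p_(n+1)(z; a, b, c, d) through
   p_n(q^(+-1/2) z; a q^(1/2), b q^(1/2), c q^(1/2), d q^(1/2)) with symmetric
   coefficients. *)
Require Import Defs.
From mathcomp Require Import all_boot all_order all_algebra.
From mathcomp Require Import complex.
From mathcomp Require Import reals sequences exp trigo.
From mathcomp Require Import ring.

Set Implicit Arguments.
Unset Strict Implicit.

Import Order.TTheory GRing.Theory Num.Theory.
Local Open Scope ring_scope.
Local Open Scope complex_scope.

(** * Elementary rules for q-shifted factorials *)

Lemma qpoch_cons (F : fieldType) (a : F) s q n :
  qpoch (a :: s) q n = (\prod_(k < n) (1 - a * q ^+ k)) * qpoch s q n.
Proof. by rewrite /qpoch big_cons. Qed.

Lemma qpoch_nil (F : fieldType) (q : F) n : qpoch [::] q n = 1.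
Proof. by rewrite /qpoch big_nil. Qed.

Lemma qpoch1E (F : fieldType) (a q : F) n :
  qpoch [:: a] q n = \prod_(k < n) (1 - a * q ^+ k).
Proof. by rewrite qpoch_cons qpoch_nil mulr1. Qed.

Lemma qpoch_cons2 (F : fieldType) (a b : F) s q n :
  qpoch [:: a, b & s] q n = qpoch [:: a] q n * qpoch (b :: s) q n.
Proof. by rewrite qpoch_cons qpoch1E. Qed.

Lemma qpoch0 (F : fieldType) s (q : F) : qpoch s q 0 = 1.
Proof. by rewrite /qpoch big1 // => a _; rewrite big_ord0. Qed.

Lemma qpoch1S (F : fieldType) (a q : F) n :
  qpoch [:: a] q n.+1 = qpoch [:: a] q n * (1 - a * q ^+ n).
Proof. by rewrite !qpoch1E big_ord_recr. Qed.

Lemma qpoch1Sl (F : fieldType) (a q : F) n :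
  qpoch [:: a] q n.+1 = (1 - a) * qpoch [:: a * q] q n.
Proof.
rewrite !qpoch1E big_ord_recl expr0 mulr1; congr (_ * _).
by apply: eq_bigr => k _; rewrite -mulrA -exprS.
Qed.

Lemma qpoch1_split (F : fieldType) (a q : F) k n : (k <= n)%N ->
  qpoch [:: a] q n = qpoch [:: a] q k * qpoch [:: a * q ^+ k] q (n - k).
Proof.
move=> /subnKC {1}<-; elim: (n - k)%N => [|l IH]; first by rewrite addn0 qpoch0 mulr1.
by rewrite addnS !qpoch1S IH exprD !mulrA.
Qed.

(** The factor of index [n] is 1 - q^-n q^n; this is what makes the sums terminate. *)
Lemma qpoch1_eq0 (F : fieldType) (q : F) n k : q != 0 -> (n < k)%N ->
  qpoch [:: q ^- n] q k = 0.
Proof.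
move=> q0 nk; rewrite qpoch1E (bigD1 (Ordinal nk)) //=.
by rewrite mulVf ?expf_neq0 // subrr mul0r.
Qed.

Lemma qpoch1_neq0_leq (F : fieldType) (a q : F) k n : (k <= n)%N ->
  qpoch [:: a] q n != 0 -> qpoch [:: a] q k != 0.
Proof. by move=> kn; rewrite (qpoch1_split _ _ kn) mulf_eq0 => /norP[]. Qed.

(** * Termwise symmetry in b, c, d, and duality *)

Lemma askey_wilson_z_swap34 (F : fieldType) (q : F) n (z a b c d : F) :
  askey_wilson_z q n z a b c d = askey_wilson_z q n z a b d c.
Proof.
rewrite /askey_wilson_z; congr (_ * _); apply: eq_bigr => k _.
rewrite !qpoch_cons2 [_ * d * c]mulrAC; ring.
Qed.

Lemma askey_wilson_z_swap23 (F : fieldType) (q : F) n (z a b c d : F) :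
  askey_wilson_z q n z a b c d = askey_wilson_z q n z a c b d.
Proof.
rewrite /askey_wilson_z; congr (_ * _); apply: eq_bigr => k _.
rewrite !qpoch_cons2 (mulrAC _ c b); ring.
Qed.

Lemma exprz_predn (F : fieldType) (q : F) n : q != 0 ->
  q ^ (n%:Z - 1) = q ^+ n / q.
Proof. by move=> q0; rewrite expfzDr // -exprnP exprN1. Qed.

(* At z = a q^m the sum in p_n contains (q^-n, q^-m;q)_k and is symmetric under
   the exchange of (n, a) with (m, a').  Only the prefactors
   (u q^k;q)_(n-k) = (u;q)_n / (u;q)_k differ. *)
Lemma askey_wilson_z_dual (F : fieldType) (q : F) n m (a b c d a' b' c' d' u v w : F) :
  q != 0 -> a != 0 -> a' != 0 ->
  a * b = u -> a * c = v -> a * d = w ->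
  a' * b' = u -> a' * c' = v -> a' * d' = w ->
  a * b * c * d = a' ^+ 2 * q -> a' * b' * c' * d' = a ^+ 2 * q ->
  qpoch [:: u; v; w] q m != 0 ->
  askey_wilson_z q n (a * q ^+ m) a b c d
  = a' ^+ m * qpoch [:: u; v; w] q n / (a ^+ n * qpoch [:: u; v; w] q m)
    * askey_wilson_z q m (a' * q ^+ n) a' b' c' d'.
Proof.
move=> q0 a0 a'0 eb ec ed eb' ec' ed' e e' Dm.
have an0 : a ^+ n != 0 by rewrite expf_neq0.
suff E : a ^+ n * qpoch [:: u; v; w] q m
    * askey_wilson_z q n (a * q ^+ m) a b c d
  = a' ^+ m * qpoch [:: u; v; w] q n
    * askey_wilson_z q m (a' * q ^+ n) a' b' c' d'.
  apply: (mulfI (mulf_neq0 an0 Dm)).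
  by rewrite E [RHS]mulrA [X in _ = X * _]mulrC divfK ?mulf_neq0.
(* Both sums are extended to k <= n + m so that they can be compared term by term. The added terms
   contain (q^-n;q)_k with k > n, respectively (q^-m;q)_k with k > m. *)
have widen r s (f : nat -> F) : (forall k, (r < k)%N -> f k = 0) ->
    \sum_(k < r.+1) f k = \sum_(k < (r + s).+1) f k.
  move=> f0; rewrite -addSn big_split_ord /= [X in _ + X]big1 ?addr0 // => i _.
  by rewrite f0 //= addSn ltnS leq_addr.
rewrite /askey_wilson_z.
rewrite (widen n m (fun k =>
    qpoch [:: a * b * q ^+ k; a * c * q ^+ k; a * d * q ^+ k] q (n - k)
    * (qpoch [:: q ^- n; q ^ (n%:Z - 1) * a * b * c * d;
                 a * (a * q ^+ m); a * (a * q ^+ m)^-1] q k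
       / qpoch [:: q] q k) * q ^+ k)); last first.
  move=> k nk; rewrite [qpoch [:: q ^- n, _ & _] _ _]qpoch_cons2.
  by rewrite qpoch1_eq0 //; ring.
rewrite (widen m n (fun k =>
    qpoch [:: a' * b' * q ^+ k; a' * c' * q ^+ k; a' * d' * q ^+ k] q (m - k)
    * (qpoch [:: q ^- m; q ^ (m%:Z - 1) * a' * b' * c' * d';
                 a' * (a' * q ^+ n); a' * (a' * q ^+ n)^-1] q k
       / qpoch [:: q] q k) * q ^+ k)); last first.
  move=> k nk; rewrite [qpoch [:: q ^- m, _ & _] _ _]qpoch_cons2.
  by rewrite qpoch1_eq0 //; ring.
rewrite [in RHS](addnC m n).
have am0 : a' ^+ m != 0 by rewrite expf_neq0.
rewrite mulrACA divff // mul1r [RHS]mulrACA divff // mul1r !mulr_sumr.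
apply: eq_bigr => /= k _.
have qn0 j : q ^+ j != 0 by rewrite expf_neq0.
(* By [e] and [e'], the parameter with the product of all four in one sum is the parameter a'z' or
   az of the other, where z' = a' q^n and z = a q^m. *)
have -> : q ^ (n%:Z - 1) * a * b * c * d = a' * (a' * q ^+ n).
  transitivity (q ^+ n / q * (a * b * c * d)); first by rewrite exprz_predn //; ring.
  by rewrite e; field.
have -> : q ^ (m%:Z - 1) * a' * b' * c' * d' = a * (a * q ^+ m).
  transitivity (q ^+ m / q * (a' * b' * c' * d')); first by rewrite exprz_predn //; ring.
  by rewrite e'; field.
have -> : a * (a * q ^+ m)^-1 = q ^- m by field; rewrite a0 qn0.
have -> : a' * (a' * q ^+ n)^-1 = q ^- n by field; rewrite a'0 qn0.
rewrite eb ec ed eb' ec' ed' !qpoch_cons2.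
case: (leqP k n) => [kn|nk]; last by rewrite (qpoch1_eq0 _ nk) //; ring.
case: (leqP k m) => [km|mk]; last by rewrite (qpoch1_eq0 _ mk) //; ring.
rewrite (qpoch1_split u q kn) (qpoch1_split v q kn) (qpoch1_split w q kn).
rewrite (qpoch1_split u q km) (qpoch1_split v q km) (qpoch1_split w q km).
ring.
Qed.

(** * Backward shift relation *)

(* The right-hand side is symmetric in a, b, c, d as soon as p_n is. *)
Lemma askey_wilson_z_backward_shift (F : fieldType) (q h : F) n (z a b c d : F) :
  h ^+ 2 = q -> q != 0 -> a != 0 -> z != 0 -> qpoch [:: q] q n.+1 != 0 ->
  (z^-1 - z) * askey_wilson_z q n.+1 z a b c d =
  h ^+ n *
  (z ^- 2 * ((1 - a * z) * (1 - b * z) * (1 - c * z) * (1 - d * z))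
     * askey_wilson_z q n (h * z) (a * h) (b * h) (c * h) (d * h)
   - z ^+ 2 * ((1 - a / z) * (1 - b / z) * (1 - c / z) * (1 - d / z))
     * askey_wilson_z q n (z / h) (a * h) (b * h) (c * h) (d * h)).
Proof.
move=> hq q0 a0 z0 qn0.
have h0 : h != 0 by apply: contraNneq q0 => h0; rewrite -hq h0 expr0n.
have qX0 j : q ^+ j != 0 by rewrite expf_neq0.
(* [X k * Y k] is the coefficient of (ahy, ah/y;q)_k in the sum for p_n(y; ah, bh, ch, dh), as
   [shift] confirms below. Expressing p_(n+1) through the same coefficients, as [S] does, reduces
   the relation to an identity for each k. *)
pose phi k := qpoch [:: a * z] q k * qpoch [:: a / z] q k.
pose E := a * b * c * d.
pose X k := qpoch [:: a * b * q * q ^+ k] q (n - k)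
  * qpoch [:: a * c * q * q ^+ k] q (n - k)
  * qpoch [:: a * d * q * q ^+ k] q (n - k).
pose Y k := qpoch [:: q ^- n] q k * qpoch [:: q * q ^+ n * E] q k / qpoch [:: q] q k * q ^+ k.
pose G k := (1 - a * b * q ^+ k) * (1 - a * c * q ^+ k) * (1 - a * d * q ^+ k) / q ^+ k.
pose H k := (1 - E * q ^+ k) / q ^+ k.
pose S := \sum_(k < n.+1) X k * Y k * (G k * phi k - H k * phi k.+1).
have Yn : Y n.+1 = 0 by rewrite /Y (qpoch1_eq0 q0 (ltnSn n)) !mul0r.
have -> : askey_wilson_z q n.+1 z a b c d = a ^- n.+1 * S.
  rewrite /askey_wilson_z; congr (_ * _).
  rewrite big_ord_recl.
  have -> : S = \sum_(k < n.+1) X k * Y k * G k * phi k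
              - \sum_(k < n.+1) X k * Y k * H k * phi k.+1.
    by rewrite -sumrB; apply: eq_bigr => k _; ring.
  (* Summation by parts: the [G] sum gains a zero term at n + 1 and loses its term at 0, so that
     after an index shift both sums run over [phi k.+1]. *)
  have -> : \sum_(k < n.+1) X k * Y k * G k * phi k = \sum_(k < n.+2) X k * Y k * G k * phi k.
    by rewrite [RHS]big_ord_recr /= Yn; ring.
  rewrite [X in _ = X - _]big_ord_recl -addrA -sumrB; congr (_ + _).
    rewrite /X /Y /G /phi !qpoch_cons2 !qpoch0 !expr0 !subn0 !qpoch1Sl !mulr1.
    by field; rewrite oner_eq0.
  apply: eq_bigr => k _; rewrite lift0.
  have kn : (k <= n)%N by rewrite -ltnS.
  have qk1 := qpoch1_neq0_leq (ltn_ord k) qn0.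
  have q1 : 1 - q * q ^+ k != 0.
    by move: qk1; rewrite qpoch1S mulf_eq0 => /norP[].
  have q2 : qpoch [:: q] q k != 0 by apply: qpoch1_neq0_leq qn0; apply: ltnW.
  (* The three factors in the numerator of [G k.+1] are the leading factors of the products in
     [X k]. At k = n these products are empty, and [Y n.+1 = 0] settles the case. *)
  have XG : X k.+1 * Y k.+1 * G k.+1 = X k * (Y k.+1 / q ^+ k.+1).
    move: kn; rewrite leq_eqVlt => /orP[/eqP ->|kn].
      by rewrite Yn; ring.
    rewrite /X /G -(subnSK kn) !qpoch1Sl !exprS !mulrA !(mulrAC _ (q ^+ k) q).
    by field; rewrite q0 qX0 qk1.
  rewrite XG subSS !qpoch_cons2.
  have -> : qpoch [:: a * b * q ^+ k.+1] q (n - k) *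
    (qpoch [:: a * c * q ^+ k.+1] q (n - k) * qpoch [:: a * d * q ^+ k.+1] q (n - k)) = X k.
    by rewrite /X !exprS !mulrA.
  have -> : qpoch [:: q ^ (n.+1%:Z - 1) * a * b * c * d] q k.+1
     = (1 - q ^+ n * E) * qpoch [:: q * q ^+ n * E] q k.
    rewrite qpoch1Sl exprz_predn // exprS /E.
    by congr ((1 - _) * qpoch [:: _] _ _); field.
  have -> : qpoch [:: q ^- n.+1] q k.+1 = (1 - q ^- n.+1) * qpoch [:: q ^- n] q k.
    rewrite qpoch1Sl exprS.
    by congr (_ * qpoch [:: _] _ _); field; rewrite q0 qX0.
  rewrite /Y /H /phi !qpoch1S !exprS.
  by field; rewrite z0 q0 !qX0 q1 q2.
have shift y k (y0 : y != 0) :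
    qpoch [:: a * h * (b * h) * q ^+ k; a * h * (c * h) * q ^+ k;
              a * h * (d * h) * q ^+ k] q (n - k)
    * (qpoch [:: q ^- n; q ^ (n%:Z - 1) * (a * h) * (b * h) * (c * h) * (d * h);
                 a * h * y; a * h * y^-1] q k
       / qpoch [:: q] q k) * q ^+ k
    = X k * Y k * (qpoch [:: a * h * y] q k * qpoch [:: a * h * y^-1] q k).
  rewrite !qpoch_cons2 /X /Y /E.
  have hh u : a * h * (u * h) = a * u * q by rewrite -hq; ring.
  have -> : q ^ (n%:Z - 1) * (a * h) * (b * h) * (c * h) * (d * h) = q * q ^+ n * (a * b * c * d).
    by rewrite exprz_predn // -hq; field.
  by rewrite !hh; ring.
rewrite /askey_wilson_z.
under [X in _ = _ * (_ * (_ * X) - _)]eq_bigr => k _ do rewrite shift ?mulf_neq0 //.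
under [X in _ = _ * (_ - _ * (_ * X))]eq_bigr => k _ do rewrite shift ?mulf_neq0 ?invr_eq0 //.
have -> : a * h * (h * z) = a * z * q by rewrite -hq; ring.
have -> : a * h * (h * z)^-1 = a / z by field; rewrite ?z0 ?h0.
have -> : a * h * (z / h) = a * z by field.
have -> : a * h * (z / h)^-1 = a / z * q by rewrite -hq; field; rewrite ?z0 ?h0.
rewrite exprMn invfM.
have an0 : a ^+ n != 0 by rewrite expf_neq0.
have hn0 : h ^+ n != 0 by rewrite expf_neq0.
rewrite !mulr_sumr -sumrB mulr_sumr.
apply: eq_bigr => /= k _.
(* The factors 1 - az and 1 - a/z of the two coefficients complete the shifted products, so that
   both sums acquire the common factor [phi k]. *)
have e1 : (1 - a * z) * qpoch [:: a * z * q] q k = qpoch [:: a * z] q k * (1 - a * z * q ^+ k).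
  by rewrite -qpoch1Sl qpoch1S.
have e2 : (1 - a / z) * qpoch [:: a / z * q] q k = qpoch [:: a / z] q k * (1 - a / z * q ^+ k).
  by rewrite -qpoch1Sl qpoch1S.
(* This step is the identity
   (z^-2 (1-uz)(1-bz)(1-cz)(1-dz) - z^2 (1-u/z)(1-b/z)(1-c/z)(1-d/z)) / (1/z - z)
   = ((1-ub)(1-uc)(1-ud) - (1-ubcd) (1-uz)(1-u/z)) / u  with u = a q^k. *)
transitivity ((X k * Y k / a ^+ n) * (qpoch [:: a * z] q k * qpoch [:: a / z] q k)
  * (z ^- 2 * (1 - a * z * q ^+ k) * ((1 - b * z) * (1 - c * z) * (1 - d * z))
    - z ^+ 2 * (1 - a / z * q ^+ k) * ((1 - b / z) * (1 - c / z) * (1 - d / z)))).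
  rewrite /phi !qpoch1S /G /H /E exprS.
  by field; rewrite a0 z0 qX0 an0.
transitivity ((X k * Y k / a ^+ n) *
  (z ^- 2 * ((1 - a * z) * qpoch [:: a * z * q] q k * qpoch [:: a / z] q k)
     * ((1 - b * z) * (1 - c * z) * (1 - d * z))
    - z ^+ 2 * ((1 - a / z) * qpoch [:: a / z * q] q k * qpoch [:: a * z] q k)
     * ((1 - b / z) * (1 - c / z) * (1 - d / z)))).
  by rewrite e1 e2; ring.
by field; rewrite z0 an0 hn0.
Qed.

(** * Full symmetry in the four parameters *)

(** In characteristic 0 the points 0, 1, ..., [size p] - 1 are distinct, which is one root more than
    a nonzero [p] can have. *)
Lemma poly_horner_eq0 (F : numFieldType) (p : {poly F}) :
  (forall x, p.[x] = 0) -> p = 0.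
Proof.
move=> p0; apply: (@roots_geq_poly_eq0 _ _ [seq i%:R | i <- iota 0 (size p)]).
- by apply/allP => x _; apply/rootP.
- by rewrite map_inj_uniq ?iota_uniq //; apply: mulrIn (oner_neq0 _).
- by rewrite size_map size_iota.
Qed.

(** Each pair of factors (1 - a q^j z)(1 - a q^j / z) equals 1 + (a q^j)^2 - a q^j (z + 1/z). *)
Lemma askey_wilson_z_polynomial (F : fieldType) (q : F) n (a b c d : F) :
  {p : {poly F} | forall z, z != 0 ->
    askey_wilson_z q n z a b c d = p.[z + z^-1]}.
Proof.
exists (a ^- n *: \sum_(k < n.+1)
  (qpoch [:: a * b * q ^+ k; a * c * q ^+ k; a * d * q ^+ k] q (n - k)
   * (qpoch [:: q ^- n; q ^ (n%:Z - 1) * a * b * c * d] q k / qpoch [:: q] q k) * q ^+ k)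
  *: \prod_(j < k) ((1 + (a * q ^+ j) ^+ 2)%:P - (a * q ^+ j) *: 'X)) => z z0.
rewrite hornerZ horner_sum /askey_wilson_z; congr (_ * _).
apply: eq_bigr => k _; rewrite hornerZ horner_prod.
have -> : \prod_(j < k) ((1 + (a * q ^+ j) ^+ 2)%:P - (a * q ^+ j) *: 'X).[z + z^-1]
    = qpoch [:: a * z] q k * qpoch [:: a * z^-1] q k.
  rewrite !qpoch1E -big_split; apply: eq_bigr => j _ /=.
  by rewrite !hornerE; field.
rewrite !qpoch_cons2; ring.
Qed.

(** The induction keeps z and the parameters general, since the backward shift changes them all.
    Together with the exchanges in b, c, d this gives every permutation of the parameters. *)
Lemma askey_wilson_z_swap12 (C : numClosedFieldType) (q : C) n (z a b c d : C) :
  q != 0 -> qpoch [:: q] q n != 0 -> a != 0 -> b != 0 -> z != 0 ->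
  askey_wilson_z q n z a b c d = askey_wilson_z q n z b a c d.
Proof.
move=> q0; elim: n z a b c d => [|n IH] z a b c d qn0 a0 b0 z0.
  by rewrite /askey_wilson_z !big_ord_recl !big_ord0 !qpoch0 !expr0.
have qn : qpoch [:: q] q n != 0 by apply: qpoch1_neq0_leq qn0.
have h0 : sqrtC q != 0 by rewrite sqrtC_eq0.
have main y : y != 0 -> (y^-1 - y) * askey_wilson_z q n.+1 y a b c d
                      = (y^-1 - y) * askey_wilson_z q n.+1 y b a c d.
  move=> y0; rewrite !(@askey_wilson_z_backward_shift _ q (sqrtC q)) ?sqrtCK //.
  rewrite (IH _ (a * _)) ?mulf_neq0 ?invr_eq0 // (IH (y / _) (a * _)) ?mulf_neq0 ?invr_eq0 //.
  ring.
(* [main] says nothing at z = 1 and z = -1, hence the passage to polynomials in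
   z + 1/z. *)
have [p pE] := askey_wilson_z_polynomial q n.+1 a b c d.
have [r rE] := askey_wilson_z_polynomial q n.+1 b a c d.
rewrite pE // rE //; congr _.[_].
(* One more factor 1/y - y makes the multiplier in [main] a polynomial in w = y + 1/y, because (1/y
   - y)^2 = w^2 - 4. Every w has this form. *)
have : ('X ^+ 2 - 4%:P) * (p - r) = 0.
  apply: poly_horner_eq0 => w; rewrite hornerM !hornerE.
  set y := joukowsky_inv (w / 2).
  have y0 : y != 0 by apply: joukowsky_inv_neq0.
  have yw : w = y + y^-1.
    have := joukowsky_invK (w / 2); rewrite -/y => e.
    by apply: (mulIf (_ : 2^-1 != 0)); rewrite ?invr_eq0 ?pnatr_eq0.
  have := main y y0; rewrite pE // rE // -yw => e.
  have -> : w ^+ 2 - 4 = (y^-1 - y) ^+ 2 by rewrite yw; field.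
  by rewrite expr2 -mulrA mulrBr e subrr mulr0.
move=> /eqP; rewrite mulf_eq0 => /orP[|].
  rewrite subr_eq0 => /eqP e.
  have := congr1 (fun p : {poly C} => p.[0]) e; rewrite !hornerE expr0n /= => /esym/eqP.
  by rewrite pnatr_eq0.
by rewrite subr_eq0 => /eqP.
Qed.

(** * Laws of complex powers *)

Lemma cexpD (R : realType) (s t : R[i]) : cexp (s + t) = cexp s * cexp t.
Proof.
case: s t => [a b] [c d]; rewrite /cexp /= expRD cosD sinD.
by apply/eqP; rewrite eq_complex /=; apply/andP; split; apply/eqP; ring.
Qed.

Lemma cexp0 (R : realType) : cexp (0 : R[i]) = 1.
Proof.
rewrite /cexp /= expR0 cos0 sin0; apply/eqP.
by rewrite eq_complex /=; apply/andP; split; apply/eqP; ring.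
Qed.

Lemma cpowD (R : realType) (l s t : R[i]) : cpow l (s + t) = cpow l s * cpow l t.
Proof. by rewrite /cpow mulrDl cexpD. Qed.

Lemma cpow0 (R : realType) (l : R[i]) : cpow l 0 = 1.
Proof. by rewrite /cpow mul0r cexp0. Qed.

Lemma cpow_neq0 (R : realType) (l s : R[i]) : cpow l s != 0.
Proof.
apply/eqP => e; have := cpow0 l; rewrite -(subrr s) cpowD e mul0r.
by move/esym/eqP; rewrite oner_eq0.
Qed.

Lemma cpowN (R : realType) (l s : R[i]) : cpow l (- s) = (cpow l s)^-1.
Proof.
by apply: (mulfI (cpow_neq0 l s)); rewrite -cpowD subrr cpow0 divff ?cpow_neq0.
Qed.

Lemma cpowMn (R : realType) (l s : R[i]) n : cpow l (s * n%:R) = cpow l s ^+ n.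
Proof.
elim: n => [|n IH]; first by rewrite mulr0 cpow0.
by rewrite -natr1 mulrDr mulr1 cpowD IH exprSr.
Qed.

(** * The four evaluations of the continuous q-Jacobi polynomials *)

Theorem theorem2p1 (R : realType) (n m : nat) (q logq alpha beta : R[i])
  (q_neq0 : q != 0) (normq_neq1 : `|q| != 1) (exp_logq : cexp logq = q)
  (denP : continuous_q_jacobi_denom q logq n alpha beta != 0)
  (den1 : qpoch [:: q] q n
          * qpoch [:: cpow logq (alpha + 1);
                      - cpow logq ((alpha + beta + 1) / 2);
                      - cpow logq ((alpha + beta + 2) / 2)] q m != 0)
  (den2 : qpoch [:: q; - cpow logq ((alpha + beta + 1) / 2)] q n
          * qpoch [:: cpow logq (alpha + 1);
                      - cpow logq ((alpha + beta + 2) / 2);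
                      - cpow logq ((alpha + beta + 3) / 2)] q m != 0)
  (den3 : qpoch [:: q] q n
          * qpoch [:: cpow logq (beta + 1);
                      - cpow logq ((alpha + beta + 1) / 2);
                      - cpow logq ((alpha + beta + 2) / 2)] q m != 0)
  (den4 : qpoch [:: q; - cpow logq ((alpha + beta + 1) / 2)] q n
          * qpoch [:: cpow logq (beta + 1);
                      - cpow logq ((alpha + beta + 2) / 2);
                      - cpow logq ((alpha + beta + 3) / 2)] q m != 0) :
  let y_n := (cpow logq ((alpha + beta + 1) / 2 + n%:R)
              + cpow logq (- ((alpha + beta + 1) / 2) - n%:R)) / 2 in
  [/\ continuous_q_jacobi q logq n alpha beta
        ((cpow logq (alpha / 2 + 1 / 4 + m%:R)
          + cpow logq (- (alpha / 2) - 1 / 4 - m%:R)) / 2)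
      = qpoch [:: cpow logq (alpha + 1)] q n
        * cpow logq ((alpha + beta + 1) / 2) ^+ m
        / (qpoch [:: q] q n
           * qpoch [:: cpow logq (alpha + 1);
                       - cpow logq ((alpha + beta + 1) / 2);
                       - cpow logq ((alpha + beta + 2) / 2)] q m)
        * askey_wilson q m y_n
            (cpow logq ((alpha + beta + 1) / 2))
            (cpow logq ((alpha - beta + 1) / 2))
            (- cpow logq (1 / 2)) (- 1),
      continuous_q_jacobi q logq n alpha beta
        ((cpow logq (alpha / 2 + 3 / 4 + m%:R)
          + cpow logq (- (alpha / 2) - 3 / 4 - m%:R)) / 2)
      = cpow logq (- (n%:R / 2))
        * cpow logq ((alpha + beta + 1) / 2) ^+ m
        * qpoch [:: cpow logq (alpha + 1);
                    - cpow logq ((alpha + beta + 3) / 2)] q n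
        / (qpoch [:: q; - cpow logq ((alpha + beta + 1) / 2)] q n
           * qpoch [:: cpow logq (alpha + 1);
                       - cpow logq ((alpha + beta + 2) / 2);
                       - cpow logq ((alpha + beta + 3) / 2)] q m)
        * askey_wilson q m y_n
            (cpow logq ((alpha + beta + 1) / 2))
            (cpow logq ((alpha - beta + 1) / 2))
            (- cpow logq (1 / 2)) (- q),
      continuous_q_jacobi q logq n alpha beta
        (- ((cpow logq (beta / 2 + 1 / 4 + m%:R)
             + cpow logq (- (beta / 2) - 1 / 4 - m%:R)) / 2))
      = (- cpow logq ((alpha - beta) / 2)) ^+ n
        * cpow logq ((alpha + beta + 1) / 2) ^+ m
        * qpoch [:: cpow logq (beta + 1)] q n
        / (qpoch [:: q] q n
           * qpoch [:: cpow logq (beta + 1);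
                       - cpow logq ((alpha + beta + 1) / 2);
                       - cpow logq ((alpha + beta + 2) / 2)] q m)
        * askey_wilson q m y_n
            (cpow logq ((alpha + beta + 1) / 2))
            (cpow logq ((beta - alpha + 1) / 2))
            (- cpow logq (1 / 2)) (- 1)
    & continuous_q_jacobi q logq n alpha beta
        (- ((cpow logq (beta / 2 + 3 / 4 + m%:R)
             + cpow logq (- (beta / 2) - 3 / 4 - m%:R)) / 2))
      = (- cpow logq ((alpha - beta - 1) / 2)) ^+ n
        * cpow logq ((alpha + beta + 1) / 2) ^+ m
        * qpoch [:: cpow logq (beta + 1);
                    - cpow logq ((alpha + beta + 3) / 2)] q n
        / (qpoch [:: q; - cpow logq ((alpha + beta + 1) / 2)] q n
           * qpoch [:: cpow logq (beta + 1);
                       - cpow logq ((alpha + beta + 2) / 2);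
                       - cpow logq ((alpha + beta + 3) / 2)] q m)
        * askey_wilson q m y_n
            (cpow logq ((alpha + beta + 1) / 2))
            (cpow logq ((beta - alpha + 1) / 2))
            (- cpow logq (1 / 2)) (- q)].
Proof.
move=> y_n.
(* All non-integral powers of q that occur are monomials in [A], [B] and [h], with h^2 = q. The
   Jacobi parameters become A, Ah, -B, -Bh, and the claims become rational identities. *)
pose A := cpow logq (alpha / 2 + 1 / 4).
pose B := cpow logq (beta / 2 + 1 / 4).
pose h := cpow logq (1 / 2).
have A0 : A != 0 by apply: cpow_neq0.
have B0 : B != 0 by apply: cpow_neq0.
have h0 : h != 0 by apply: cpow_neq0.
have cq : cpow logq 1 = q by rewrite /cpow mul1r.
have hq : q = h * h by rewrite -cq -cpowD; congr cpow; field.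
have cqn k : cpow logq k%:R = q ^+ k by rewrite -[k%:R]mul1r cpowMn cq.
have eA3 : cpow logq (alpha / 2 + 3 / 4) = A * h.
  by rewrite -cpowD; congr cpow; field.
have eB3 : cpow logq (beta / 2 + 3 / 4) = B * h.
  by rewrite -cpowD; congr cpow; field.
have es1 : cpow logq ((alpha + beta + 1) / 2) = A * B.
  by rewrite -cpowD; congr cpow; field.
have es2 : cpow logq ((alpha + beta + 2) / 2) = A * B * h.
  by rewrite -!cpowD; congr cpow; field.
have es3 : cpow logq ((alpha + beta + 3) / 2) = A * B * q.
  by rewrite -cq -!cpowD; congr cpow; field.
have ea : cpow logq (alpha + 1) = A ^+ 2 * h.
  by rewrite expr2 -!cpowD; congr cpow; field.
have eb : cpow logq (beta + 1) = B ^+ 2 * h.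
  by rewrite expr2 -!cpowD; congr cpow; field.
have et : cpow logq ((alpha - beta + 1) / 2) = A / B * h.
  by rewrite -cpowN -!cpowD; congr cpow; field.
have et' : cpow logq ((beta - alpha + 1) / 2) = B / A * h.
  by rewrite -cpowN -!cpowD; congr cpow; field.
have er : cpow logq ((alpha - beta) / 2) = A / B.
  by rewrite -cpowN -!cpowD; congr cpow; field.
have er' : cpow logq ((alpha - beta - 1) / 2) = A / (B * h).
  by rewrite -cpowD -cpowN -!cpowD; congr cpow; field.
have ehn : cpow logq (- (n%:R / 2)) = h ^- n.
  by rewrite cpowN -cpowMn; congr (cpow _ _)^-1; field.
have ezV x k (y z : R[i]) (e : cpow logq (x / 2 + y) = z) :
    (cpow logq (x / 2 + y + k%:R) + cpow logq (- (x / 2) - y - k%:R)) / 2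
    = (z * q ^+ k + (z * q ^+ k)^-1) / 2.
  by rewrite -e -cqn -cpowD -cpowN; congr ((_ + cpow _ _) / _); ring.
have ey : y_n = (A * B * q ^+ n + (A * B * q ^+ n)^-1) / 2.
  rewrite /y_n -es1 -cqn -cpowD -cpowN; congr ((_ + cpow _ _) / _); ring.
(* The outer sign moves into z, so that the last two points belong to z = e q^m with e = -B and e =
   -Bh. *)
have zN (z : R[i]) : - ((z * q ^+ m + (z * q ^+ m)^-1) / 2)
    = (- z * q ^+ m + (- z * q ^+ m)^-1) / 2.
  by rewrite [- z * _]mulNr invrN; ring.
have qX0 k : q ^+ k != 0 by rewrite expf_neq0.
have qn0 : qpoch [:: q] q n != 0.
  by move: den1; rewrite mulf_eq0 => /norP[].
rewrite !(ezV _ _ _ _ (erefl _)) -/A -/B eA3 eB3 !zN ey.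
rewrite /continuous_q_jacobi cpowMn -/A.
rewrite eA3 -/B eB3 -/h et et' es1 ea eb er er' ehn.
clearbody A B h.
rewrite !askey_wilsonE ?mulf_neq0 ?oppr_eq0 ?mulf_neq0 //.
move: denP den1 den2 den3 den4.
rewrite /continuous_q_jacobi_denom es1 es2 es3 ea eb !qpoch_cons2 !mulf_eq0.
move=> /norP[_ /norP[sn0 shn0]].
move=> /norP[_ /norP[am0 /norP[sm0 shm0]]].
move=> /norP[_ /norP[_ /norP[_ sqm0]]].
move=> /norP[_ /norP[bm0 _]] _.
have An0 k : A ^+ k != 0 by rewrite expf_neq0.
have Bn0 k : B ^+ k != 0 by rewrite expf_neq0.
have hn0 k : h ^+ k != 0 by rewrite expf_neq0.
have s0 : A * B != 0 by rewrite mulf_neq0.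
have sk0 k : (A * B) ^+ k != 0 by rewrite expf_neq0.
split.
(* Here e = A. In all four cases a' = AB is a square root of abcd/q, and b' = ab/a', c' = ac/a', d'
   = ad/a'. The exchanges bring e to the front and put the rest in the order of the stated dual
   parameters. *)
- rewrite askey_wilson_z_swap34.
  rewrite (@askey_wilson_z_dual _ q n m A (A * h) (- (B * h)) (- B)
    (A * B) (A / B * h) (- h) (- 1)
    (A ^+ 2 * h) (- (A * B * h)) (- (A * B))) //;
    try by [ring | rewrite hq; field | field; rewrite ?B0 ?A0].
    rewrite !qpoch_cons2; field.
    by rewrite ?sk0 ?An0 ?Bn0 ?hn0 ?A0 ?B0 ?h0 ?qn0 ?sn0 ?shn0 ?am0 ?bm0 ?sm0 ?shm0 ?sqm0.
  by rewrite !qpoch_cons2 !mulf_neq0.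
(* Here e = Ah, and the order reached is Ah, A, -B, -Bh. *)
- rewrite askey_wilson_z_swap12 ?mulf_neq0 //.
  rewrite (@askey_wilson_z_dual _ q n m (A * h) A (- B) (- (B * h))
    (A * B) (A / B * h) (- h) (- q)
    (A ^+ 2 * h) (- (A * B * h)) (- (A * B * q))) ?mulf_neq0 //;
    try by [ring | rewrite hq; field | rewrite hq; ring | field; rewrite ?B0 ?A0].
    rewrite !qpoch_cons2 [(A * h) ^+ n]exprMn; field.
    by rewrite ?sk0 ?An0 ?Bn0 ?hn0 ?A0 ?B0 ?h0 ?qn0 ?sn0 ?shn0 ?am0 ?bm0 ?sm0 ?shm0 ?sqm0.
  by rewrite !qpoch_cons2 !mulf_neq0.
(* Here e = -B, and the order reached is -B, -Bh, Ah, A. *)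
- rewrite askey_wilson_z_swap23 askey_wilson_z_swap12 ?oppr_eq0 ?mulf_neq0 ?oppr_eq0 //.
  rewrite askey_wilson_z_swap34 askey_wilson_z_swap23 askey_wilson_z_swap34.
  rewrite (@askey_wilson_z_dual _ q n m (- B) (- (B * h)) (A * h) A
    (A * B) (B / A * h) (- h) (- 1)
    (B ^+ 2 * h) (- (A * B * h)) (- (A * B))) ?oppr_eq0 //;
    try by [ring | rewrite hq; field | rewrite hq; ring | field; rewrite ?B0 ?A0].
    rewrite !qpoch_cons2 -[- (A / B)]mulrN -invrN [(A / _) ^+ n]exprMn exprVn.
    (* The power (-B)^n is generalized so that it enters [field] as a single atom. *)
    have : (- B) ^+ n != 0 by rewrite expf_neq0 ?oppr_eq0.
    move: ((- B) ^+ n) => Bn {}Bn0.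
    field.
    by rewrite ?sk0 ?An0 ?Bn0 ?hn0 ?A0 ?B0 ?h0 ?qn0 ?sn0 ?shn0 ?am0 ?bm0 ?sm0 ?shm0 ?sqm0.
  by rewrite !qpoch_cons2 !mulf_neq0.
(* Here e = -Bh, and the order reached is -Bh, -B, A, Ah. *)
- rewrite askey_wilson_z_swap34 askey_wilson_z_swap23 askey_wilson_z_swap12
    ?oppr_eq0 ?mulf_neq0 ?oppr_eq0 ?mulf_neq0 //.
  rewrite askey_wilson_z_swap34 askey_wilson_z_swap23.
  rewrite (@askey_wilson_z_dual _ q n m (- (B * h)) (- B) A (A * h)
    (A * B) (B / A * h) (- h) (- q)
    (B ^+ 2 * h) (- (A * B * h)) (- (A * B * q))) ?oppr_eq0 ?mulf_neq0 //;
    try by [ring | rewrite hq; field | rewrite hq; ring | field; rewrite ?B0 ?A0].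
    rewrite !qpoch_cons2 -[- (A / (B * h))]mulrN -invrN [(A / _) ^+ n]exprMn exprVn.
    have : (- (B * h)) ^+ n != 0 by rewrite expf_neq0 ?oppr_eq0 ?mulf_neq0.
    move: ((- (B * h)) ^+ n) => Bhn Bhn0.
    field.
    by rewrite ?sk0 ?An0 ?Bhn0 ?hn0 ?A0 ?B0 ?h0 ?qn0 ?sn0 ?shn0 ?am0 ?bm0 ?sm0 ?shm0 ?sqm0.
  by rewrite !qpoch_cons2 !mulf_neq0.
Qed.
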